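(* (Matsumoto's theorem for atomic reduced expressions in type $A$.) Let $W=\mathcal{S}_n$, $S=\{s_1,\dots,s_{n-1}\}$, let $I,J\subset S$ and let $p$ be a core $(I,J)$-coset. Then any two atomic reduced expressions of $p$ are related by a sequence of atomic braid relations $$\mathtt a_i.\mathtt a_{i+1}.\mathtt a_i\ \leftrightarrow\ \mathtt a_{i+1}.\mathtt a_i.\mathtt a_{i+1},\qquad \mathtt a_i.\mathtt a_j\ \leftrightarrow\ \mathtt a_j.\mathtt a_i\ \ (|i-j|>1).$$
   Context: $W=\mathcal S_n$ with simple reflections $s_i=(i\ i{+}1)$ and length $\ell$. For $I\subset S$, $W_I$ is the parabolic subgroup, $w_I$ its longest element, $\ell(I)=\ell(w_I)$. An $(I,J)$-coset is an element $p\in W_I\backslash W/W_J$ (with $(I,J)$ part of the data), with Bruhat-maximal element $\overline p$ and Bruhat-minimal element $\underline p$. It is a core coset if $I=\underline pJ\underline p^{-1}$. Composition: let $*$ be the $0$-Hecke (star) product on $W$ ($s*w=sw$ if $\ell(sw)>\ell(w)$, else $s*w=w$). For an $(I,J)$-coset $p$ and a $(J,K)$-coset $q$, $p*q=W_I(\overline p*\overline q)W_K$, and $\overline{p*q}=\overline p*\overline q$. It is reduced, written $p.q$, if $\overline p*\overline q=(\overline pw_J^{-1})\overline q$ with $\ell(\overline p*\overline q)=\ell(\overline p)-\ell(J)+\ell(\overline q)$. A longer composition is reduced if each successive binary composition is. Atomic cosets: for $J\subset S$ write $S\setminus J=\{s_{d_1},\dots,s_{d_l}\}$ with $d_1<\dots<d_l$.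 For $s=s_{d_i}$, put $M=J\cup\{s\}$ and $t=w_Msw_M$; $\mathtt a_i^J$ denotes the $(M\setminus\{t\},J)$-coset containing $w_M$. These are exactly the atomic cosets ending in $J$. An atomic reduced expression for $p$ is a sequence of composable atomic cosets $\mathtt a^{J_d}_{i_d},\dots,\mathtt a^{J_0}_{i_0}$ (with $J_0=J$) whose composition $\mathtt a^{J_d}_{i_d}*\cdots*\mathtt a^{J_0}_{i_0}$ is reduced and equal to $p$ (the empty sequence is allowed for an identity coset). The superscripts are determined by $J_0$ and the indices, so they are omitted. An atomic braid relation replaces a consecutive subsequence of an atomic reduced expression by the other side of one of the displayed relations, with superscripts the unique ones making the composition well defined with the same rightmost subset. *)

(* Defs.v *)
From mathcomp Require Import all_boot all_fingroup.

Set Implicit Arguments.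
Unset Strict Implicit.
Unset Printing Implicit Defensive.

Local Open Scope group_scope.

(* The set S of simple reflections is indexed, from 0, by 'I_n.-1, so subsets
   of S are elements of {set 'I_n.-1}.  In MathComp, (x * y) i = y (x i); this
   is the opposite of the usual composition of permutations, but inversion is
   an isomorphism between the two groups that fixes every simple reflection,
   so both give the same Coxeter system. *)

Lemma simple_subproof n (i : 'I_n.-1) : i.+1 < n.
Proof. by case: n i => [|n] [i]. Qed.

Definition simple_refl {n} (i : 'I_n.-1) : 'S_n :=
  tperm (Ordinal (ltnW (simple_subproof i))) (Ordinal (simple_subproof i)).

Definition simples {n} (I : {set 'I_n.-1}) : {set 'S_n} := simple_refl @: I.

Definition word_prod {n} (s : seq 'I_n.-1) : 'S_n := \prod_(i <- s) simple_refl i.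

Lemma simple_generate n : <<simples [set: 'I_n.-1]>> = [set: 'S_n].
Proof.
set G := <<_>>.
have tpG k : forall a b : 'I_n, a + k.+1 = b -> tperm a b \in G.
  elim: k => [|k IHk] a b ab.
    have lt_a : a < n.-1 by rewrite ltn_predRL (_ : a.+1 = b) // -ab addn1.
    apply/mem_gen/imsetP; exists (Ordinal lt_a) => //.
    by congr tperm; apply: val_inj => //=; rewrite -ab addn1.
  have lt_c : a + k.+1 < n.
    by apply: ltn_trans (ltn_ord b); rewrite -ab ltn_add2l.
  set c : 'I_n := Ordinal lt_c.
  have cb : c.+1 = b by rewrite -ab [RHS]addnS.
  have lt_cn : c < n.-1 by rewrite ltn_predRL cb.
  have cbG : tperm c b \in G.
    apply/mem_gen/imsetP; exists (Ordinal lt_cn) => //.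
    by congr tperm; apply: val_inj => //=; rewrite -cb.
  have -> : tperm a b = tperm a c ^ tperm c b.
    have lt_ac : a < c by rewrite /= -[X in X < _]addn0 ltn_add2l.
    have lt_cb : c < b by rewrite -ab /= ltn_add2l.
    rewrite tpermJ tpermL tpermD // -val_eqE gtn_eqF //.
    exact: ltn_trans lt_ac lt_cb.
  by rewrite groupJ // IHk.
have tpG' (a b : 'I_n) : tperm a b \in G.
  case: (ltngtP a b) => [lt_ab | lt_ba | /val_inj ->]; last by rewrite tperm1 group1.
    by apply: (tpG (b - a).-1); rewrite prednK ?subn_gt0 // subnKC // ltnW.
  by rewrite tpermC; apply: (tpG (a - b).-1); rewrite prednK ?subn_gt0 // subnKC // ltnW.
apply/setP=> s; rewrite inE; have [ts -> _] := prod_tpermP s.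
by apply: group_prod => t _.
Qed.

Lemma word_exists n (w : 'S_n) :
  exists k, [exists s : k.-tuple 'I_n.-1, word_prod s == w].
Proof.
have: w \in <<simples [set: 'I_n.-1]>> by rewrite simple_generate inE.
case/gen_prodgP=> k [c cS ->]; exists k.
have /fin_all_exists [d Ed] i : exists j, c i = simple_refl j.
  by have /imsetP[j _ ->] := cS i; exists j.
apply/existsP; exists [tuple d i | i < k]; apply/eqP.
rewrite /word_prod big_tuple; apply: eq_bigr => i _.
by rewrite tnth_mktuple Ed.
Qed.

Definition ell {n} (w : 'S_n) : nat := ex_minn (word_exists w).

Lemma redword_exists n (w : 'S_n) :
  exists s : (ell w).-tuple 'I_n.-1, word_prod s == w.
Proof. by apply/existsP; rewrite /ell; case: ex_minnP. Qed.

Definition redword {n} (w : 'S_n) : (ell w).-tuple 'I_n.-1 :=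
  xchoose (redword_exists w).

Definition reflection {n} (t : 'S_n) : bool :=
  [exists i : 'I_n.-1, t \in simple_refl i ^: [set: 'S_n]].

Definition bruhat_step {n} : rel 'S_n := fun u v =>
  [exists t, reflection t && (v == u * t)] && (ell u < ell v).

Definition bruhat {n} : rel 'S_n := connect bruhat_step.

Definition parab {n} (I : {set 'I_n.-1}) : {set 'S_n} := <<simples I>>.

Definition longest {n} (I : {set 'I_n.-1}) : 'S_n :=
  [arg max_(w > 1 in parab I) ell w].

Definition star_simple {n} (i : 'I_n.-1) (w : 'S_n) : 'S_n :=
  if ell w < ell (simple_refl i * w) then simple_refl i * w else w.

(* x * y = s_1 * (s_2 * (... * (s_k * y))) for a reduced word s_1 ... s_k of x;
   the value does not depend on the reduced word. *)
Definition star {n} (x y : 'S_n) : 'S_n :=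
  foldr star_simple y (redword x).

Definition dcos {n} (I J : {set 'I_n.-1}) (x : 'S_n) : {set 'S_n} :=
  parab I * [set x] * parab J.

Record dcoset {n : nat} (I J : {set 'I_n.-1}) := DCoset {
  dcoset_set :> {set 'S_n};
  _ : dcoset_set \in [set dcos I J x | x in [set: 'S_n]] }.

Definition dcoset_of {n} (I J : {set 'I_n.-1}) (x : 'S_n) : dcoset I J :=
  DCoset (imset_f (dcos I J) (in_setT x)).

(* The greatest and least elements of a double coset for the Bruhat order
   always exist: the default value 1 is never used. *)
Definition cmax {n} (I J : {set 'I_n.-1}) (p : dcoset I J) : 'S_n :=
  odflt 1 [pick x in dcoset_set p | [forall y in dcoset_set p, bruhat y x]].

Definition cmin {n} (I J : {set 'I_n.-1}) (p : dcoset I J) : 'S_n :=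
  odflt 1 [pick x in dcoset_set p | [forall y in dcoset_set p, bruhat x y]].

Definition is_core {n} (I J : {set 'I_n.-1}) (p : dcoset I J) : Prop :=
  simples I = [set cmin p * s * (cmin p)^-1 | s in simples J].

Definition dcompose {n} (I J K : {set 'I_n.-1}) (p : dcoset I J) (q : dcoset J K) :
  dcoset I K := dcoset_of I K (star (cmax p) (cmax q)).

(* The length condition is written without (truncated) subtraction. *)
Definition reduced_comp {n} (I J K : {set 'I_n.-1})
    (p : dcoset I J) (q : dcoset J K) : Prop :=
  star (cmax p) (cmax q) = cmax p * (longest J)^-1 * cmax q /\
  (ell (star (cmax p) (cmax q)) + ell (longest J) =
     ell (cmax p) + ell (cmax q))%N.

Definition id_dcoset {n} (J : {set 'I_n.-1}) : dcoset J J := dcoset_of J J 1.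

Definition atomic_left {n} (J : {set 'I_n.-1}) (d : 'I_n.-1) : {set 'I_n.-1} :=
  let M := d |: J in
  [set j in M | simple_refl j != longest M * simple_refl d * longest M].

(* When s_d is the i-th element of S \ J, this is the atomic coset a_i^J. *)
Definition atomic {n} (J : {set 'I_n.-1}) (d : 'I_n.-1) :
  dcoset (atomic_left J d) J := dcoset_of _ J (longest (d |: J)).

(* [atomic_rex p w]: the list of indices w = [:: i_d; ...; i_0] is an atomic
   reduced expression a_{i_d} ... a_{i_0} of the (I, J)-coset p, with rightmost
   subset J.  The superscripts, being determined by J and w, are not recorded:
   the one of a new leftmost letter is the left subset I of the coset expressed
   so far.  Indices start from 1; the enumeration of ~: I is increasing. *)
Inductive atomic_rex {n} (J : {set 'I_n.-1}) :
  forall I : {set 'I_n.-1}, dcoset I J -> seq nat -> Prop :=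
| Atomic_nil : atomic_rex (id_dcoset J) [::]
| Atomic_cons I (p : dcoset I J) w k d :
    atomic_rex p w -> onth (enum (~: I)) k = Some d ->
    reduced_comp (atomic I d) p ->
    atomic_rex (dcompose (atomic I d) p) (k.+1 :: w).

Inductive atomic_braid : seq nat -> seq nat -> Prop :=
| Braid3 u v i :
    atomic_braid (u ++ [:: i; i.+1; i] ++ v) (u ++ [:: i.+1; i; i.+1] ++ v)
| Braid2 u v i j : (i.+1 < j) || (j.+1 < i) ->
    atomic_braid (u ++ [:: i; j] ++ v) (u ++ [:: j; i] ++ v).

Definition braid_step {n} (I J : {set 'I_n.-1}) (p : dcoset I J)
    (w w' : seq nat) : Prop :=
  [/\ atomic_rex p w, atomic_rex p w' & atomic_braid w w'].

(* Main.v *)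
(* A core (I, J)-coset matches the W_I-orbits (blocks) of {1..n} with the W_J-orbits,
   and the atomic coset a_i exchanges the i-th and (i+1)-st blocks.  If z is the maximal
   element of p, the composition a_i * p is reduced exactly when z does not
   already invert these two blocks: for M = I :|: {s}, the condition says that
   every element of M is a left descent of w_M w_I z.  Hence atomic reduced expressions
   of p are the reduced words of the permutation of blocks determined by p, and
   the theorem becomes Matsumoto's theorem for a symmetric group, proved by the
   exchange argument.  Maximal elements and star products are identified as
   the unique elements with full descent sets, by the lifting property of the
   Bruhat order. *)

Require Import Defs.
From mathcomp Require Import all_boot all_fingroup.
From mathcomp Require Import zify.
From Stdlib Require Import Relation_Operators.

Set Implicit Arguments.
Unset Strict Implicit.
Unset Printing Implicit Defensive.

(** * Sorting words *)

Definition sw (i x : nat) : nat :=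
  if x == i then i.+1 else if x == i.+1 then i else x.

Fixpoint wact (w : seq nat) : nat -> nat :=
  if w is i :: w' then wact w' \o sw i else id.

(** These are the reduced words for permutations of [1, ..., m]: each prepended letter [i] creates a
    new inversion. In [wact] the leftmost letter acts first. *)
Fixpoint sorting (m : nat) (w : seq nat) : bool :=
  if w is i :: w' then [&& 0 < i < m, wact w' i < wact w' i.+1 & sorting m w']
  else true.

Lemma swK i : involutive (sw i).
Proof. by move=> x; rewrite /sw; do !case: eqP => //=; lia. Qed.

Lemma wact_inj w : injective (wact w).
Proof. by elim: w => //= i w IH; apply: inj_comp => //; apply: inv_inj (swK i). Qed.

Lemma wact_fix m w x : sorting m w -> (x == 0) || (m < x) -> wact w x = x.
Proof.
move=> + hx; elim: w => //= i w IH /and3P[hi _ /IH]; move=> E; rewrite -[RHS]E.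
by congr wact; rewrite /sw; do !case: eqP => //=; lia.
Qed.

(** * Braid equivalence and the exchange argument *)

Definition sorting_step m (w w' : seq nat) : Prop :=
  [/\ sorting m w, sorting m w', wact w =1 wact w' & atomic_braid w w'].

Definition braided m := clos_refl_sym_trans (seq nat) (sorting_step m).

Lemma braided_inv m w w' : braided m w w' -> sorting m w ->
  [/\ sorting m w', wact w =1 wact w' & size w = size w'].
Proof.
move=> H.
(* An equality of booleans, unlike an implication, passes through the symmetric case of the
   closure. *)
have [E [e1 e2]] : sorting m w = sorting m w' /\ wact w =1 wact w' /\ size w = size w'.
  elim: H => {w w'} [w w' [-> -> eqa b] | w | w w' _ [-> [e ->]]
    | u v w _ [-> [e1 ->]] _ [-> [e2 ->]]]; split=> //; split=> //.
    by case: b => *; rewrite !size_cat.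
  exact: ftrans e1 e2.
by rewrite E.
Qed.

Lemma atomic_braid_cons i w w' : atomic_braid w w' -> atomic_braid (i :: w) (i :: w').
Proof.
by case=> [u v j | u v j k h]; [apply: (@Braid3 (i :: u)) | apply: (@Braid2 (i :: u))].
Qed.

Lemma braided_cons m i w w' : braided m w w' ->
  sorting m (i :: w) -> braided m (i :: w) (i :: w').
Proof.
elim=> {w w'} [w w' [sw1 sw2 e b] | w | w w' H IH | u v w H1 IH1 H2 IH2] sor.
- apply: rst_step; split=> //; last exact: atomic_braid_cons.
    by move: sor => /= /and3P[-> + _]; rewrite !e sw2 => ->.
  by move=> x /=; rewrite e.
- exact: rst_refl.
- apply/rst_sym/IH; move: sor => /= /and3P[hi hl hw'].
  have [hw e _] := braided_inv (rst_sym _ _ _ _ H) hw'.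
  by rewrite hi hw -!e hl.
- apply: rst_trans (IH1 sor) (IH2 _); move: sor => /= /and3P[hi hl hw].
  have [hv e _] := braided_inv H1 hw.
  by rewrite hi hv -!e hl.
Qed.

Lemma braided_commute m i j w : (i.+1 < j) || (j.+1 < i) ->
  sorting m [:: i, j & w] -> braided m [:: i, j & w] [:: j, i & w].
Proof.
move=> hij H; apply: rst_step; split=> //; last exact: (@Braid2 [::] w i j).
- move: H => /=; rewrite /sw; do !case: eqP => //=; lia.
- by move=> x /=; congr wact; rewrite /sw; do !case: eqP => //=; lia.
Qed.

Lemma braided_braid m i j w : (j == i.+1) || (i == j.+1) ->
  sorting m [:: i, j, i & w] -> braided m [:: i, j, i & w] [:: j, i, j & w].
Proof.
move=> hij H; have H' : sorting m [:: j, i, j & w].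
  move: H => /=; case/orP: hij => /eqP->; rewrite /sw; do !case: eqP => //=; lia.
have e : wact [:: i, j, i & w] =1 wact [:: j, i, j & w].
  by move=> x /=; congr wact; case/orP: hij => /eqP->; rewrite /sw; do !case: eqP => //=; lia.
case/orP: hij => /eqP E; subst.
  by apply: rst_step; split=> //; apply: (@Braid3 [::] w i).
by apply/rst_sym/rst_step; split=> //; apply: (@Braid3 [::] w j).
Qed.

(** The exchange property by braid moves alone: the first letter [i] of [w] equals [j], commutes
    with it, or is adjacent to it; in the last case [i, j, i] can be brought to the front. *)
Lemma braided_exchange m w j : sorting m w -> 0 < j < m ->
  wact w j.+1 < wact w j -> exists r, braided m w (j :: r).
Proof.
(* The bound on the length lets the adjacent case use the hypothesis twice, on [u] and on a word one
   letter shorter. *)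
have [N] := ubnP (size w); elim: N w j => // N IH [|i u] j /=; first by lia.
rewrite ltnS => szu sor hj des; have := sor => /and3P[hi hl su].
have [eij | nij] := eqVneq i j.
  by exists u; rewrite eij; apply: rst_refl.
have [far | near] := boolP ((i.+1 < j) || (j.+1 < i)).
  have [|r Hr] := IH u j szu su hj.
    by move: des; rewrite /sw; do !case: eqP => //=; lia.
  exists (i :: r); have Hc := braided_cons Hr sor.
  apply: (rst_trans _ _ _ _ _ Hc (braided_commute far _)).
  by have [] := braided_inv Hc sor.
(* Here [w] reverses the three values at the positions moved by [i] and [j], so [u] descends at [j]
   and, once that letter is removed, the rest descends at [i]. *)
have adj : (j == i.+1) || (i == j.+1) by lia.
have [|r1 Hr1] := IH u j szu su hj.
  by move: des hl; case/orP: adj => /eqP->; rewrite /sw; do !case: eqP => //=; lia.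
have [sor1 e1 sz1] := braided_inv Hr1 su.
have [//|||r2 Hr2] := IH r1 i _ _ hi.
- by move: sz1 szu => /=; lia.
- by move: sor1 => /= /and3P[].
- move: des hl; rewrite !e1 /=.
  by case/orP: adj => /eqP->; rewrite /sw; do !case: eqP => //=; lia.
exists [:: i, j & r2].
have C1 := braided_cons Hr1 sor; have [sor2 _ _] := braided_inv C1 sor.
have sor3 : sorting m (j :: r1) by move: sor2 => /= /and3P[].
have C2 := braided_cons (braided_cons Hr2 sor3) sor2.
have [sor4 _ _] := braided_inv C2 sor2.
exact: rst_trans C1 (rst_trans _ _ _ _ _ C2 (braided_braid adj sor4)).
Qed.

(** The first letter of [w'] is a descent of [w], so exchange brings it to the front of [w]; cancel
    it on both sides and recurse. *)
Lemma sorting_matsumoto m w w' : sorting m w -> sorting m w' ->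
  wact w =1 wact w' -> braided m w w'.
Proof.
elim: w' w => [|j v IH] w sow sow' e.
  case: w sow e => [|i u] /=; first by move=> *; apply: rst_refl.
  (* A nonempty sorting word inverts [i] and [i.+1] for its first letter [i], so it cannot act as
     the identity. *)
  move=> /and3P[_ + _] e; have := e i; have := e i.+1; rewrite /= /sw.
  by do !case: eqP => //=; lia.
have := sow' => /= /and3P[hj hl sov].
have [|r Hr] := @braided_exchange m w j sow hj.
  by rewrite !e /= /sw; do !case: eqP => //=; lia.
have [/[dup] sor' /= /and3P[_ _ sor] er _] := braided_inv Hr sow.
apply: (rst_trans _ _ _ _ _ Hr (braided_cons _ sor')); apply: IH => // x.
by have := er (sw j x); rewrite e /= swK.
Qed.

Local Open Scope group_scope.

(** * Lengths in the symmetric group *)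

Section Coxeter.
Variable n : nat.
Implicit Types (i j c d e : 'I_n.-1) (I J M : {set 'I_n.-1}) (u v w x y z : 'S_n).
Implicit Types (a b : 'I_n) (s : seq 'I_n.-1).

(** Since [(x * y) a = y (x a)], left multiplication by [simple_refl i] exchanges the values at
    positions [lo i] and [hi i]; a left descent of [w] reads [w (hi i) < w (lo i)]. *)
Definition lo i : 'I_n := Ordinal (ltnW (simple_subproof i)).
Definition hi i : 'I_n := Ordinal (simple_subproof i).
Local Notation r := simple_refl.

Lemma simple_reflE i : r i = tperm (lo i) (hi i). Proof. by []. Qed.

Lemma simple_lo i : r i (lo i) = hi i. Proof. exact: tpermL. Qed.
Lemma simple_hi i : r i (hi i) = lo i. Proof. exact: tpermR. Qed.

Lemma lo_neq_hi i : lo i != hi i.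
Proof. by rewrite -val_eqE /= neq_ltn ltnSn. Qed.

Lemma simpleK i : r i * r i = 1. Proof. exact: tperm2. Qed.

Lemma simpleV i : (r i)^-1 = r i. Proof. exact: tpermV. Qed.

Lemma simpleMK i w : r i * (r i * w) = w.
Proof. by rewrite mulgA simpleK mul1g. Qed.

Lemma simple_inj : injective (@simple_refl n).
Proof.
move=> i j /(congr1 (fun w : 'S_n => (w (lo i), w (hi i)))) [].
rewrite simple_lo simple_hi; rewrite !simple_reflE.
do ![case: tpermP => [|] /(congr1 val) /=|case: tpermP => /=] => *; apply: val_inj => /=;
  repeat match goal with H : _ = _ :> 'I_n |- _ => move/(congr1 val): H => /= H end; lia.
Qed.

Lemma simple_lt i a b : a < b -> (a, b) != (lo i, hi i) -> r i a < r i b.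
Proof.
rewrite -pair_eqE /= -!val_eqE /= simple_reflE.
case: tpermP => [->|->|/eqP + /eqP +]; (case: tpermP => [->|->|/eqP + /eqP +]);
  rewrite -?val_eqE /=; lia.
Qed.

Lemma ell_le s : ell (word_prod s) <= size s.
Proof.
rewrite /ell; case: ex_minnP => k _; apply.
by apply/existsP; exists (in_tuple s).
Qed.

Lemma redword_prod w : word_prod (redword w) = w.
Proof. exact/eqP/(xchooseP (redword_exists w)). Qed.

Lemma word_cons i s : word_prod (i :: s) = r i * word_prod s.
Proof. by rewrite /word_prod big_cons. Qed.

(* Somewhere along the word the values [word_prod s a > word_prod s b] get
   exchanged; deleting that letter undoes the exchange. *)
Lemma word_deletion s a b : a < b -> word_prod s b < word_prod s a ->
  exists2 s', size s' < size s & word_prod s' = tperm a b * word_prod s.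
Proof.
elim: s a b => [|i s IH] a b ltab; first by rewrite /word_prod big_nil !perm1; lia.
rewrite word_cons !permM => lt'.
have [[-> ->]|neq] := eqVneq (a, b) (lo i, hi i).
  by exists s => //=; rewrite -simple_reflE simpleMK.
have [s' sz' e'] := IH _ _ (simple_lt ltab neq) lt'.
exists (i :: s') => //; rewrite word_cons e' -tpermJ conjgE simpleV.
by rewrite -!mulgA simpleMK.
Qed.

Lemma ell_tperm a b w : a < b -> w b < w a -> ell (tperm a b * w) < ell w.
Proof.
move=> ltab; have := @word_deletion (redword w) a b ltab.
rewrite redword_prod size_tuple => H /H[s' sz' <-].
exact: leq_ltn_trans (ell_le s') sz'.
Qed.

Lemma ell_tperm_gt a b w : a < b -> w a < w b -> ell w < ell (tperm a b * w).
Proof.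
move=> ltab lt'; have := @ell_tperm a b (tperm a b * w) ltab.
by rewrite mulgA tperm2 mul1g !permM tpermL tpermR; apply.
Qed.

Lemma ell_tpermE a b w : a < b -> (ell w < ell (tperm a b * w)) = (w a < w b).
Proof.
move=> ltab; apply/idP/idP; last exact: ell_tperm_gt.
apply: contraTT; rewrite -leqNgt leq_eqVlt => /orP[/eqP/val_inj/perm_inj eab|/(ell_tperm ltab)].
  by rewrite eab ltnn in ltab.
by lia.
Qed.

Lemma ell_simple_le i w : ell (r i * w) <= (ell w).+1.
Proof.
rewrite -{1}(redword_prod w) -word_cons; apply: leq_trans (ell_le _) _.
by rewrite /= size_tuple.
Qed.

Lemma ell_simple i w : w (hi i) < w (lo i) -> ell w = (ell (r i * w)).+1.
Proof.
move=> h; have lt' : ell (r i * w) < ell w by apply: ell_tperm.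
by apply/eqP; rewrite eqn_leq lt' -{1}(simpleMK i w) ell_simple_le.
Qed.

Lemma ell_simpleE i w : (ell w < ell (r i * w)) = (w (lo i) < w (hi i)).
Proof. exact: ell_tpermE. Qed.

Lemma perm_ltn_total w a b : a != b -> (w b < w a) = ~~ (w a < w b).
Proof.
move=> neq; rewrite -leqNgt ltn_neqAle (_ : (w b != w a :> nat)) //.
by rewrite val_eqE (inj_eq perm_inj) eq_sym.
Qed.

(** * The Bruhat order *)

Lemma reflection_tperm a b : a < b -> reflection (tperm a b).
Proof.
move=> ltab; have lta : a < n.-1 by have := ltn_ord b; lia.
apply/existsP; exists (Ordinal lta); apply/imsetP.
exists (tperm (hi (Ordinal lta)) b); first by rewrite inE.
rewrite simple_reflE tpermJ tpermL tpermD.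
- by congr tperm; apply: val_inj.
- by rewrite -val_eqE /=; lia.
- by rewrite -val_eqE /=; lia.
Qed.

(** Right multiplication by a reflection exchanges two values, which is left multiplication by the
    transposition of their positions; the length condition then compares these values. *)
Lemma bruhat_stepP u v : reflect
  (exists a b, [/\ a < b, u a < u b & v = tperm a b * u]) (bruhat_step u v).
Proof.
apply: (iffP andP) => [[/existsP[t /andP[/existsP[i /imsetP[g _ ->]] /eqP->]]]|].
  rewrite simple_reflE tpermJ => lt_ell.
  set a := u^-1 (g (lo i)); set b := u^-1 (g (hi i)).
  have e : u * tperm (g (lo i)) (g (hi i)) = tperm a b * u.
    by rewrite -[g (lo i)](permKV u) -[g (hi i)](permKV u) -tpermJ conjgE !mulgA mulgV mul1g.
  have neq : a != b by rewrite !(inj_eq perm_inj) lo_neq_hi.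
  rewrite e in lt_ell *.
  have [ltab|ltba|/val_inj eab] := ltngtP a b; last by rewrite eab eqxx in neq.
    by exists a, b; rewrite -(ell_tpermE _ ltab).
  by exists b, a; rewrite -(ell_tpermE _ ltba) tpermC.
move=> [a [b [ltab lt' ->]]]; split; last exact: ell_tperm_gt.
apply/existsP; exists (tperm (u a) (u b)); rewrite reflection_tperm //=.
by rewrite -tpermJ conjgE !mulgA mulgV mul1g.
Qed.

Lemma bruhat_refl u : bruhat u u. Proof. exact: (connect0 bruhat_step u). Qed.

Lemma bruhat_ell u v : bruhat u v -> (u == v) || (ell u < ell v).
Proof.
case/connectP=> p + ->; elim: p u => [|w p IH] u /=; first by rewrite eqxx.
case/andP=> /andP[_ lt_uw] /IH /orP[/eqP<-|h]; first by rewrite lt_uw orbT.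
by rewrite (ltn_trans lt_uw h) orbT.
Qed.

Lemma bruhat_anti u v : bruhat u v -> bruhat v u -> u = v.
Proof.
move=> /bruhat_ell /orP[/eqP//|h1] /bruhat_ell /orP[/eqP//|h2].
by have := ltn_trans h1 h2; rewrite ltnn.
Qed.

Lemma bruhat_inv u v : bruhat u v -> bruhat u^-1 v^-1.
Proof.
case/connectP=> p + ->; elim: p u => [|w p IH] u /=; first by move=> _; apply: bruhat_refl.
case/andP=> /bruhat_stepP[a [b [ltab lt' ->]]] /IH; apply: connect_trans.
apply/connect1/bruhat_stepP; exists (u a), (u b); rewrite !permK; split=> //.
by rewrite invMg tpermV -tpermJ conjgE !mulgA mulgK.
Qed.

Lemma bruhat_simple_up i w : w (lo i) < w (hi i) -> bruhat w (r i * w).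
Proof. by move=> h; apply/connect1/bruhat_stepP; exists (lo i), (hi i). Qed.

Lemma bruhat_simple_down i w : w (hi i) < w (lo i) -> bruhat (r i * w) w.
Proof.
move=> h; rewrite -{2}(simpleMK i w); apply: bruhat_simple_up.
by rewrite !permM simple_lo simple_hi.
Qed.

(** Multiply a chain from [y] to [z] by [r i] on the left. Its steps remain steps until one of them
    is multiplication by [r i] itself, where the two chains merge; if none is, the descent of [z]
    closes the chain. *)
Lemma bruhat_lift i y z : bruhat y z -> z (hi i) < z (lo i) -> bruhat (r i * y) z.
Proof.
case/connectP=> p + ->; elim: p y => [|w p IH] y /=; first by move=> _; apply: bruhat_simple_down.
case/andP=> /bruhat_stepP[a [b [ltab lt' ew]]] pth des.
have [[ea eb]|neq] := eqVneq (a, b) (lo i, hi i).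
  by rewrite ea eb in ew; rewrite -simple_reflE in ew; rewrite -ew; apply/connectP; exists p.
apply: connect_trans (IH _ pth des); apply/connect1/bruhat_stepP.
exists (r i a), (r i b); rewrite !permM !tpermK ew; split=> //; first exact: simple_lt.
by rewrite -tpermJ conjgE simpleV -!mulgA simpleMK.
Qed.

(** By lifting, such a [z] is Bruhat-greatest in [parab I * z]. *)
Definition ldes I z := forall i, i \in I -> z (hi i) < z (lo i).

Lemma bruhat_ldes I u y z : u \in parab I -> ldes I z -> bruhat y z -> bruhat (u * y) z.
Proof.
move=> /gen_prodgP[k [c cI ->]] dz; move: y.
elim: k c cI => [|k IH] c cI y yz; first by rewrite big_ord0 mul1g.
rewrite big_ord_recl -mulgA; have /imsetP[i iI ->] := cI ord0.
by apply: bruhat_lift (dz _ iI); apply: IH => // l.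
Qed.

Lemma bruhat_rdes J u y z : u \in parab J -> ldes J z^-1 -> bruhat y z -> bruhat (y * u) z.
Proof.
move=> uJ dz /bruhat_inv yz; rewrite -[y * u]invgK -[z]invgK; apply: bruhat_inv.
by rewrite invMg; apply: (bruhat_ldes _ dz yz); rewrite groupV.
Qed.

(** * Greatest elements of double cosets *)

Lemma bruhat_dcos I J y z : ldes I z -> ldes J z^-1 -> y \in dcos I J z -> bruhat y z.
Proof.
move=> dI dJ /mulsgP[v w /mulsgP[u z' uI /set1P-> ->] wJ ->].
exact: bruhat_rdes wJ dJ (bruhat_ldes uI dI (bruhat_refl z)).
Qed.

Lemma dcos_id I J x : x \in dcos I J x.
Proof.
by rewrite /dcos -[X in X \in _]mulg1 -[X in X * 1]mul1g !mem_mulg ?set11 ?group1.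
Qed.

Lemma dcos_eq I J x y : y \in dcos I J x -> dcos I J y = dcos I J x.
Proof.
move=> /mulsgP[v w /mulsgP[u z' uI /set1P-> ->] wJ ->]; rewrite /dcos /parab.
by rewrite -!mulg_set1 !mulgA rcoset_id // -(mulgA _ [set w]) (lcoset_id wJ).
Qed.

Lemma dcoset_eq I J (p q : dcoset I J) : dcoset_set p = dcoset_set q -> p = q.
Proof. by case: p q => [A pA] [B pB] /= eAB; subst; congr DCoset; apply: bool_irrelevance. Qed.

Lemma dcoset_of_eq I J (p : dcoset I J) x : x \in dcoset_set p -> p = dcoset_of I J x.
Proof.
by case: p => [A pA] /= xA; apply: dcoset_eq => /=; move: xA; case/imsetP: pA => y _ -> /dcos_eq.
Qed.

(** By [bruhat_dcos], [z] is a greatest element, so the choice in [cmax] succeeds, and antisymmetry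
    identifies the chosen element with [z]. *)
Lemma cmax_eq I J (p : dcoset I J) z :
  ldes I z -> ldes J z^-1 -> z \in dcoset_set p -> cmax p = z.
Proof.
move=> dI dJ zp; have zmax y : y \in dcoset_set p -> bruhat y z.
  by rewrite (dcoset_of_eq zp); apply: bruhat_dcos.
rewrite /cmax; case: pickP => [x /andP[xp /forall_inP xmax]|/(_ z)] /=.
  by apply: bruhat_anti; [apply: zmax | apply: xmax].
by rewrite zp => /negP[]; apply/forall_inP.
Qed.

End Coxeter.

(** * Blocks of a parabolic subgroup *)

Section Blocks.
Variable n : nat.
Implicit Types (i j c d e : 'I_n.-1) (I J M : {set 'I_n.-1}) (u v w x y z : 'S_n).
Implicit Types (a b : 'I_n) (s : seq 'I_n.-1).
Local Notation r := simple_refl.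

(* The number of the block of [I] that contains position [k], counting blocks
   from 1 to match the letters of [atomic_rex]. *)
Definition blk I (k : nat) : nat := #|[set c : 'I_n.-1 | (c \notin I) && (c < k)]|.+1.

Lemma blk_mono I : {homo blk I : k l / k <= l}.
Proof.
move=> k l kl; apply/subset_leq_card/subsetP=> c; rewrite !inE => /andP[-> ck].
exact: leq_trans ck kl.
Qed.

Lemma blkS I i : blk I i.+1 = blk I i + (i \notin I).
Proof.
rewrite /blk addSn; congr S; have [iI|niI] := boolP (i \in I).
  rewrite addn0; apply: eq_card => c; rewrite !inE ltnS leq_eqVlt.
  by have [/val_inj->|//] := eqVneq (val c) i; rewrite iI.
rewrite addnC -[RHS](_ : #|i |: [set c | (c \notin I) && (c < i)]| = _); last first.
  by rewrite cardsU1 !inE ltnn andbF.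
apply: eq_card => c; rewrite !inE ltnS leq_eqVlt.
by have [/val_inj->|ne] := eqVneq (val c) i; rewrite ?niI ?eqxx // -val_eqE (negPf ne).
Qed.

Lemma blk_lo_hi I i : (blk I (lo i) == blk I (hi i)) = (i \in I).
Proof. by rewrite /= blkS; case: (i \in I) => /=; rewrite ?addn0 ?eqxx ?addn1; lia. Qed.

Lemma blk_between I i k l : k <= i < l -> blk I k = blk I l -> i \in I.
Proof.
move=> /andP[ki il] e; rewrite -blk_lo_hi eqn_leq blk_mono //=.
by apply: leq_trans (blk_mono I ki); rewrite e blk_mono.
Qed.

(** A block is an interval whose neighbouring positions are all linked by elements of [I], so a
    transitive comparison of neighbours spreads to the whole block. *)
Lemma blk_chain T (R : rel T) I (f : 'I_n -> T) : transitive R ->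
  (forall i, i \in I -> R (f (lo i)) (f (hi i))) ->
  forall a b, a < b -> blk I a = blk I b -> R (f a) (f b).
Proof.
move=> Rtr fR a b; have [m] := ubnP (b - a); elim: m a => // m IH a ltm ltab eab.
have lta : a < n.-1 by have := ltn_ord b; lia.
set i := Ordinal lta; have ea : a = lo i by apply: val_inj.
have iI : i \in I by apply: blk_between eab; rewrite leqnn.
have [eb|nb] := eqVneq (val b) i.+1.
  by rewrite ea (_ : b = hi i) ?fR //; apply: val_inj.
rewrite {1}ea; apply: Rtr (fR i iI) _; apply: IH; rewrite /=.
- by move: nb => /=; lia.
- by move: nb => /=; lia.
- by rewrite -eab; apply/esym/eqP; rewrite [_ == _](blk_lo_hi I i).
Qed.

Lemma ldes_chain I z a b : ldes I z -> a < b -> blk I a = blk I b -> z b < z a.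
Proof.
move=> dz; apply: (@blk_chain _ (fun x y : 'I_n => y < x)) => // x y t /=.
by move=> h1 h2; apply: ltn_trans h2 h1.
Qed.

Definition linc I z := forall i, i \in I -> z (lo i) < z (hi i).

Lemma linc_chain I z a b : linc I z -> a < b -> blk I a = blk I b -> z a < z b.
Proof.
move=> dz; apply: (@blk_chain _ (fun x y : 'I_n => x < y)) => // x y t /=.
exact: ltn_trans.
Qed.

Lemma simple_parab I i : i \in I -> r i \in parab I.
Proof. by move=> iI; apply/mem_gen/imset_f. Qed.

Lemma parab_blk I u a : u \in parab I -> blk I (u a) = blk I a.
Proof.
case/gen_prodgP=> k [c cI ->]; elim: k c cI a => [|k IH] c cI a.
  by rewrite big_ord0 perm1.
rewrite big_ord_recl permM IH //; have /imsetP[i iI ->] := cI ord0.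
rewrite -blk_lo_hi in iI; rewrite simple_reflE.
by case: tpermP => [->|->|//]; rewrite (eqP iI).
Qed.

(** An element of [parab I] preserves every block, so it cannot invert two neighbours in different
    blocks. *)
Lemma parab_ltn I u i : u \in parab I -> u (hi i) < u (lo i) -> i \in I.
Proof.
move=> uI lt'; rewrite -blk_lo_hi eqn_leq blk_mono ?leqnSn //.
by rewrite -(parab_blk (lo i) uI) -(parab_blk (hi i) uI) blk_mono // ltnW.
Qed.

(** * Longest elements and the star product *)

Lemma longest_parab I : longest I \in parab I.
Proof. by rewrite /longest; case: arg_maxnP; rewrite ?group1. Qed.

Lemma ldes_longest I : ldes I (longest I).
Proof.
move=> i iI; rewrite perm_ltn_total ?lo_neq_hi // -ell_simpleE -leqNgt.
rewrite {2}/longest; case: arg_maxnP => [|w wI]; first exact: group1.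
by apply; rewrite groupM ?longest_parab ?simple_parab.
Qed.

Lemma bruhat_ldes_coset I u z : u \in parab I -> ldes I z -> bruhat (u * z) z.
Proof. by move=> uI dz; apply: bruhat_ldes uI dz (bruhat_refl z). Qed.

Lemma ldes_coset_uniq I u z : u \in parab I -> ldes I z -> ldes I (u * z) -> u * z = z.
Proof.
move=> uI dz duz; apply: bruhat_anti; first exact: bruhat_ldes_coset dz.
by rewrite -{1}(mulKg u z); apply: (bruhat_ldes_coset _ duz); rewrite groupV.
Qed.

(** The inverse lies in [parab I], hence below [longest I]; inversion preserves the Bruhat order,
    which gives the opposite inequality. *)
Lemma longestV I : (longest I)^-1 = longest I.
Proof.
have h : bruhat (longest I)^-1 (longest I).
  rewrite -{1}[_^-1](mulgKV (longest I)); apply: (bruhat_ldes_coset _ (@ldes_longest I)).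
  by rewrite groupM ?groupV ?longest_parab.
by apply: bruhat_anti => //; rewrite -{1}[longest I]invgK; apply: bruhat_inv.
Qed.

Lemma longestK I : involutive (longest I : 'S_n).
Proof. by move=> a; rewrite -{1}longestV permK. Qed.

Lemma longestMK I z : longest I * (longest I * z) = z.
Proof. by rewrite -{1}longestV mulKg. Qed.

Lemma longest_ltn I a b : blk I a = blk I b -> (longest I a < longest I b) = (b < a).
Proof.
move=> eab; have [ltba|ltab|/val_inj->] := ltngtP b a; last by rewrite ltnn.
  by rewrite (ldes_chain (@ldes_longest I)).
by rewrite ltnNge ltnW // (ldes_chain (@ldes_longest I)).
Qed.

Lemma reduced_word_cons i s : ell (word_prod (i :: s)) = size (i :: s) ->
  word_prod s (lo i) < word_prod s (hi i) /\ ell (word_prod s) = size s.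
Proof.
move=> /= red; have le_s := ell_le s.
have lt' : ell (word_prod s) < ell (r i * word_prod s) by rewrite -word_cons red ltnS.
split; first by rewrite -ell_simpleE.
by apply/eqP; rewrite eqn_leq le_s -ltnS -red word_cons ell_simple_le.
Qed.

(** The first letter of a reduced word is a left descent, hence lies in [M] by [parab_ltn]; peel it
    off. *)
Lemma reduced_word_parab M s : ell (word_prod s) = size s -> word_prod s \in parab M ->
  all (mem M) s.
Proof.
elim: s => //= i s IH red sM; have [lt' red'] := reduced_word_cons red.
have iM : i \in M.
  by apply: parab_ltn sM _; rewrite word_cons !permM simple_lo simple_hi.
rewrite iM IH // -(simpleMK i (word_prod s)) -word_cons.
by rewrite groupM ?simple_parab.
Qed.

Lemma word_parab M s : all (mem M) s -> word_prod s \in parab M.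
Proof.
elim: s => [|i s IH] /=; first by rewrite /word_prod big_nil group1.
by case/andP=> iM sM; rewrite word_cons groupM ?simple_parab ?IH.
Qed.

(** The word permutes each [M]-block and [z] is increasing there, so a letter that lengthens the
    word also lengthens its product with [z]: every star step multiplies. *)
Lemma star_linc M s z : linc M z -> all (mem M) s -> ell (word_prod s) = size s ->
  foldr star_simple z s = word_prod s * z /\ ell (word_prod s * z) = size s + ell z.
Proof.
move=> incz; elim: s => [|i s IH] /=; first by rewrite /word_prod big_nil mul1g.
case/andP=> iM sM red; have [lt' red'] := reduced_word_cons red.
have [-> ez] := IH sM red'.
have lt2 : (word_prod s * z)%g (lo i) < (word_prod s * z)%g (hi i).
  rewrite !permM; apply: linc_chain incz lt' _.
  by rewrite !parab_blk ?word_parab //; apply/eqP; rewrite blk_lo_hi.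
rewrite /star_simple ell_simpleE lt2 word_cons -mulgA; split=> //.
rewrite (@ell_simple _ i) ?simpleMK ?ez //.
by rewrite !permM simple_lo simple_hi -!permM.
Qed.

Lemma star_linc_parab M u z : linc M z -> u \in parab M ->
  star u z = u * z /\ ell (u * z) = ell u + ell z.
Proof.
move=> incz uM; have eu : ell (word_prod (redword u)) = size (redword u).
  by rewrite redword_prod size_tuple.
have [] := star_linc incz (reduced_word_parab eu _) eu; rewrite redword_prod // size_tuple.
by [].
Qed.

Lemma star_simple_des i y : star_simple i y (hi i) < star_simple i y (lo i).
Proof.
rewrite /star_simple ell_simpleE; case: ifP => [lt'|/negbT].
  by rewrite !permM simple_lo simple_hi.
by rewrite -perm_ltn_total ?lo_neq_hi.
Qed.

Lemma star_simple_ge i y : bruhat y (star_simple i y).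
Proof.
rewrite /star_simple ell_simpleE; case: ifP => [|_]; last exact: bruhat_refl.
exact: bruhat_simple_up.
Qed.

Lemma star_simple_mono i y z : bruhat y z -> bruhat (star_simple i y) (star_simple i z).
Proof.
move=> yz; have yz' : bruhat y (star_simple i z).
  exact: (connect_trans (e := bruhat_step)) yz (star_simple_ge i z).
rewrite {1}/star_simple; case: ifP => // _.
exact: bruhat_lift yz' (star_simple_des i z).
Qed.

Lemma star_ge u y : bruhat y (star u y).
Proof.
rewrite /star; elim: (tval (redword u)) => [|i s IH] /=; first exact: bruhat_refl.
exact: (connect_trans (e := bruhat_step)) IH (star_simple_ge i _).
Qed.

Lemma star_mono u y z : bruhat y z -> bruhat (star u y) (star u z).
Proof.
by rewrite /star; elim: (tval (redword u)) => //= i s IH /IH; apply: star_simple_mono.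
Qed.

Lemma star_coset M u y : u \in parab M -> exists2 v, v \in parab M & star u y = v * y.
Proof.
move=> uM; have sM : all (mem M) (redword u).
  by apply: reduced_word_parab; rewrite redword_prod ?size_tuple.
rewrite /star; elim: (tval (redword u)) sM => [|i s IH] /=.
  by exists 1; rewrite ?group1 ?mul1g.
case/andP=> iM /IH[v vM ->]; rewrite /star_simple; case: ifP => _; last by exists v.
by exists (r i * v); rewrite ?mulgA ?groupM ?simple_parab.
Qed.

Lemma linc_exists M z : exists2 u, u \in parab M & linc M (u * z).
Proof.
pose u := [arg min_(u < 1 in parab M) ell (u * z)].
have [uM umin] : u \in parab M /\ (forall v, v \in parab M -> ell (u * z) <= ell (v * z)).
  by rewrite /u; case: arg_minnP => [|? ? ?]; rewrite ?group1.
exists u => // i iM; rewrite -ell_simpleE.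
have := umin (r i * u); rewrite groupM ?simple_parab // -mulgA => /(_ isT).
rewrite leq_eqVlt => /orP[/eqP e|//].
have [lt'|] := boolP ((u * z)%g (lo i) < (u * z)%g (hi i)).
  by move: lt'; rewrite -ell_simpleE.
by rewrite -perm_ltn_total ?lo_neq_hi // => /ell_simple; rewrite -e => /n_Sn.
Qed.

(* [star (longest M)] is monotone and maps the shortest element of [parab M * z]
   to its longest one. *)
Lemma ldes_star_longest M z : ldes M (star (longest M) z).
Proof.
have [v vM incz] := linc_exists M z.
have [e1 _] := star_linc_parab incz (longest_parab M).
have [u uM eu] := star_coset z (longest_parab M).
have d1 : ldes M (longest M * (v * z)).
  move=> i iM; rewrite !(permM (longest M)); apply: linc_chain incz _ _.
    exact: ldes_longest.
  by rewrite !parab_blk ?longest_parab //; apply/esym/eqP; rewrite blk_lo_hi.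
suff -> : star (longest M) z = longest M * (v * z) by [].
apply: bruhat_anti.
  rewrite eu (_ : u * z = (u * v^-1 * (longest M)^-1) * (longest M * (v * z))).
    by apply: (bruhat_ldes_coset _ d1); rewrite ?groupM ?groupV ?longest_parab.
  by rewrite !mulgA !mulgKV.
rewrite -e1; apply: star_mono.
rewrite -{2}(mulKg v z); have [<- _] := star_linc_parab incz (groupVr vM).
exact: star_ge.
Qed.

(** The star product stays in [parab M * z] and has all of [M] as descents; only one element of the
    coset does. *)
Lemma star_longest M u z : u \in parab M -> ldes M (u * z) ->
  star (longest M) z = u * z.
Proof.
move=> uM duz; have [v vM ev] := star_coset z (longest_parab M).
have := @ldes_star_longest M z; rewrite ev -{1 2}(mulKg u z) mulgA => dv.
by rewrite (ldes_coset_uniq _ duz) // groupM ?groupV.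
Qed.

(** [longest M * z] is increasing on the [M]-blocks, so lengths add when [longest M] is put back. *)
Lemma ell_ldes M z : ldes M z -> ell z = ell (longest M) + ell (longest M * z).
Proof.
move=> dz; have incz : linc M (longest M * z).
  move=> i iM; rewrite !permM; apply: ldes_chain dz _ _; first exact: ldes_longest.
  by rewrite !parab_blk ?longest_parab //; apply/esym/eqP; rewrite blk_lo_hi.
by have [_] := star_linc_parab incz (longest_parab M); rewrite longestMK.
Qed.

End Blocks.

(** * Atomic cosets as exchanges of blocks *)

Section Atomic.
Variable n : nat.
Implicit Types (i j c d e : 'I_n.-1) (I J M : {set 'I_n.-1}) (u v x y z : 'S_n).
Implicit Types (a b : 'I_n) (w : seq nat).
Local Notation r := simple_refl.

(** [longest (d |: I)] reverses the block of [d], so it sends the neighbours [lo d], [hi d] to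
    neighbours [hi e], [lo e], and conjugation by it turns [simple_refl d] into [simple_refl e]. *)
Lemma atomic_leftP I d : exists e, [/\ e \in d |: I, atomic_left I d = (d |: I) :\ e &
  lo e = longest (d |: I) (hi d)].
Proof.
set M := d |: I; have dM : d \in M by rewrite !inE eqxx.
have edM : blk M (lo d) = blk M (hi d) by apply/eqP; rewrite blk_lo_hi.
set x := longest M (hi d); set y := longest M (lo d).
have ltxy : x < y by rewrite longest_ltn // ltnSn.
have bx : blk M x = blk M (hi d) by rewrite parab_blk ?longest_parab.
have by_ : blk M y = blk M (hi d) by rewrite parab_blk ?longest_parab.
have lte : x < n.-1 by have := ltn_ord y; lia.
pose e := Ordinal lte; have ex : lo e = x by apply: val_inj.
have eM : e \in M by apply: (@blk_between _ M e x y); rewrite ?leqnn ?bx.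
(* A position strictly between [x] and [y] would be reflected strictly between [lo d] and [hi d]. *)
have ey : hi e = y.
  apply/val_inj/eqP; rewrite eqn_leq /= ltxy leqNgt; apply/negP=> lt2.
  have eb : blk M (hi e) = blk M (hi d).
    by rewrite -bx -ex; apply/esym/eqP; rewrite blk_lo_hi.
  have h1 : longest M (hi e) < hi d.
    by rewrite -(longestK M (hi d)) longest_ltn -/x ?eb ?bx // -ex.
  have h2 : lo d < longest M (hi e).
    by rewrite -(longestK M (lo d)) longest_ltn -/y ?eb ?by_.
  by move: h1 h2 => /=; lia.
exists e; split=> //; apply/setP=> j; rewrite inE in_setD1 andbC; congr (_ && _).
rewrite (_ : longest M * r d * longest M = r e) ?(inj_eq (@simple_inj n)) //.
rewrite -{1}longestV -mulgA -conjgE (simple_reflE d) tpermJ -/x -/y -ex -ey.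
by rewrite tpermC.
Qed.

Lemma blk_setU1 I d k : d \notin I -> blk I k = blk (d |: I) k + (d < k).
Proof.
move=> dI; rewrite /blk addSn; congr S; rewrite (cardsD1 d) !inE dI addnC /=.
congr (_ + _); apply: eq_card => c; rewrite !inE negb_or.
by case: (c == d) => //; rewrite andbF.
Qed.

(** The new cut [e] mirrors [d] in the merged block, so the reversal carries the part left of [e] to
    the part right of [d] and conversely. Positions in other blocks keep their block number. *)
Lemma blk_atomic_left I d a : d \notin I ->
  blk (atomic_left I d) a = sw (blk I d) (blk I (longest (d |: I) a)).
Proof.
move=> dI; have [e [eM -> lo_e]] := atomic_leftP I d; set M := d |: I.
have bM : blk M (longest M a) = blk M a by rewrite parab_blk ?longest_parab.
have be : blk M e = blk M d.
  have /= -> := congr1 val lo_e; rewrite parab_blk ?longest_parab //.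
  by apply/esym/eqP; rewrite (blk_lo_hi M d) !inE eqxx.
have -> : blk (M :\ e) a = blk M a + (e < a).
  by rewrite (@blk_setU1 (M :\ e) e) ?setD1K // !inE eqxx.
rewrite !(@blk_setU1 I d) // -/M ltnn addn0 bM.
have e_hi : blk M (hi d) = blk M d by apply/esym/eqP; rewrite (blk_lo_hi M d) !inE eqxx.
have mono k l : blk M k < blk M l -> k < l.
  by apply: contraTT; rewrite -!leqNgt; apply: blk_mono.
have [ea|lta|gta] := ltngtP (blk M a) (blk M d).
- have := mono (longest M a) d; rewrite bM => /(_ ea) h1.
  have := mono a e; rewrite be => /(_ ea) h2.
  by rewrite /sw; do !case: eqP; lia.
- have := mono d (longest M a); rewrite bM => /(_ lta) h1.
  have := mono e a; rewrite be => /(_ lta) h2.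
  by rewrite /sw; do !case: eqP; lia.
(* Inside the merged block the reversal turns the part up to [e] into the part beyond [d]. *)
have -> : (d < longest M a) = ~~ (e < a).
  rewrite -leqNgt; have /= -> := congr1 val lo_e.
  rewrite [RHS]leqNgt -{2}(longestK M a) longest_ltn -?leqNgt //.
  by rewrite parab_blk ?longest_parab // e_hi.
by rewrite gta /sw; case: (e < a); do !case: eqP; lia.
Qed.

Lemma card_atomic_left I d : d \notin I -> #|atomic_left I d| = #|I|.
Proof.
move=> dI; have [e [eM -> _]] := atomic_leftP I d.
by have := cardsD1 e (d |: I); rewrite eM cardsU1 dI => -[].
Qed.

Lemma cmax_atomic I d : cmax (atomic I d) = longest (d |: I).
Proof.
apply: cmax_eq; last exact: dcos_id.
  by move=> i; rewrite inE => /andP[iM _]; apply: ldes_longest.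
by rewrite longestV => i iI; apply: ldes_longest; rewrite inE iI orbT.
Qed.

(** The shape of the maximal element of a coset expressed by [w]: it carries the [k]-th [I]-block
    onto the [J]-block numbered [wact w k], reversing the order inside. *)
Record arranges J I z w : Prop := Arranges {
  arr_card : #|I| = #|J|;
  arr_des : ldes I z;
  arr_blk : forall a, blk J (z a) = wact w (blk I a) }.

Lemma arr_cardC J I z w : arranges J I z w -> #|~: I| = #|~: J|.
Proof. by case=> cI _ _; apply: (@addnI #|I|); rewrite cardsC cI cardsC. Qed.

(** Neighbours in a [J]-block have preimages in a single [I]-block, because [wact w] is injective,
    and [z] is decreasing there. *)
Lemma arr_rdes J I z w : arranges J I z w -> ldes J z^-1.
Proof.
case=> _ dz bz j jJ; set x := z^-1 (hi j); set y := z^-1 (lo j).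
have exy : blk I x = blk I y.
  apply: (@wact_inj w); rewrite -!bz !permKV.
  by apply/esym/eqP; rewrite blk_lo_hi.
have [//|ltyx|/val_inj/perm_inj e] := ltngtP x y; last first.
  by have := lo_neq_hi j; rewrite e eqxx.
have := ldes_chain dz ltyx (esym exy); rewrite !permKV /=.
by rewrite ltnNge leqnSn.
Qed.

Lemma arr_cmax J I (p : dcoset I J) z w :
  arranges J I z w -> z \in dcoset_set p -> cmax p = z.
Proof. by move=> az; apply: cmax_eq (arr_rdes az); case: az. Qed.

Lemma blk_longest I a : blk I (longest I a) = blk I a.
Proof. by rewrite parab_blk ?longest_parab. Qed.

(** [longest I * z] is increasing on each [I]-block, and the inequality on [wact w] orders the
    images of the two merged blocks. It thus increases on every [M]-block, where [longest M]
    reverses positions. *)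
Lemma ldes_atomic_arr J I z w d : d \notin I -> arranges J I z w ->
  wact w (blk I d) < wact w (blk I d).+1 -> ldes (d |: I) (longest (d |: I) * (longest I * z)).
Proof.
move=> dI [cI dz bz] lt_act i iM; rewrite !permM; set M := d |: I in iM *.
set x := longest M (hi i); set y := longest M (lo i).
have ebM : blk M (hi i) = blk M (lo i) by apply/esym/eqP; rewrite blk_lo_hi.
have ltxy : x < y by rewrite longest_ltn ?ltnSn.
have [eI|nI] := eqVneq (blk I x) (blk I y).
  by apply: ldes_chain dz _ _; rewrite ?blk_longest // longest_ltn.
have lt_blk : blk I x < blk I y by rewrite ltn_neqAle nI blk_mono // ltnW.
(* Positions of one [M]-block that lie in different [I]-blocks are separated by the cut [d]. *)
have [ex ey] : blk I x = blk I d /\ blk I y = (blk I d).+1.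
  have bxy : blk M x = blk M y by rewrite !blk_longest.
  move: lt_blk; rewrite !(blk_setU1 _ dI) -/M ltnn bxy.
  case: (ltnP d x) => dx; case: (ltnP d y) => dy; try lia.
  have dM : d \in M by rewrite !inE eqxx.
  suff <- : blk M y = blk M d by lia.
  apply/eqP; rewrite eqn_leq -{1}bxy !blk_mono //; exact: ltnW.
rewrite ltnNge; apply/negP=> /(@blk_mono _ J).
by rewrite !bz !blk_longest ex ey leqNgt lt_act.
Qed.

Lemma arranges_atomic J I z w d : d \notin I -> arranges J I z w ->
  ldes (d |: I) (longest (d |: I) * (longest I * z)) ->
  arranges J (atomic_left I d) (longest (d |: I) * (longest I * z)) (blk I d :: w).
Proof.
move=> dI [cI dz bz] dM; split; first by rewrite card_atomic_left.
  by move=> i; rewrite inE => /andP[iM _]; apply: dM.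
by move=> a; rewrite !permM bz blk_longest /= blk_atomic_left // swK.
Qed.

(** The star product descends at every element of [M]. At the new cut [e], between the two exchanged
    blocks, this descent compares their [J]-block numbers, which differ by injectivity. *)
Lemma act_lt_reduced J I (p : dcoset I J) w d : d \notin I -> arranges J I (cmax p) w ->
  reduced_comp (atomic I d) p -> wact w (blk I d) < wact w (blk I d).+1.
Proof.
move=> dI az [+ _]; rewrite cmax_atomic longestV -mulgA => est.
have dM : ldes (d |: I) (longest (d |: I) * (longest I * cmax p)).
  by rewrite -est; apply: ldes_star_longest.
have [e [eM eI lo_e]] := atomic_leftP I d.
have [_ _ bz'] := arranges_atomic dI az dM.
have := ltnW (dM e eM) => /(@blk_mono _ J); rewrite !bz' leq_eqVlt.
have e1 : blk (atomic_left I d) (lo e) = blk I d.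
  rewrite blk_atomic_left // lo_e longestK.
  by rewrite [blk I (hi d)](blkS I d) dI addn1 /sw eqxx; case: eqP; lia.
have -> : blk (atomic_left I d) (hi e) = (blk I d).+1.
  by rewrite [LHS](blkS _ e) eI !inE eqxx -eI [X in X + _]e1 addn1.
rewrite e1 /= (inj_eq (@wact_inj w)) !/sw.
by do !case: eqP => //=; lia.
Qed.

(** Both lengths are measured from [longest I * cmax p]: multiplying it by [longest (d |: I)] or by
    [longest I] adds lengths, by [ell_ldes]. *)
Lemma reduced_act_lt J I (p : dcoset I J) w d : d \notin I -> arranges J I (cmax p) w ->
  wact w (blk I d) < wact w (blk I d).+1 -> reduced_comp (atomic I d) p.
Proof.
move=> dI az lt_act; have dM := ldes_atomic_arr dI az lt_act.
have dz := arr_des az; rewrite /reduced_comp cmax_atomic longestV.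
have -> : star (longest (d |: I)) (cmax p) = longest (d |: I) * (longest I * cmax p).
  rewrite mulgA; apply: star_longest; rewrite -?mulgA //.
  rewrite groupM ?longest_parab //; apply: subsetP (longest_parab I).
  by apply/genS/imsetS; apply: subsetUr.
split; first by rewrite mulgA.
rewrite (ell_ldes dM) longestMK.
by rewrite (ell_ldes dz) -addnA (addnC (ell _) (ell (longest I))).
Qed.

Lemma arr_dcompose J I (p : dcoset I J) w d : d \notin I -> arranges J I (cmax p) w ->
  reduced_comp (atomic I d) p ->
  arranges J (atomic_left I d) (cmax (dcompose (atomic I d) p)) (blk I d :: w) /\
  cmax (dcompose (atomic I d) p) \in dcoset_set (dcompose (atomic I d) p).
Proof.
move=> dI az red; have lt_act := act_lt_reduced dI az red.
have az' := arranges_atomic dI az (ldes_atomic_arr dI az lt_act).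
have mem : longest (d |: I) * (longest I * cmax p) \in dcoset_set (dcompose (atomic I d) p).
  by case: red => /= -> _; rewrite cmax_atomic longestV -mulgA dcos_id.
by rewrite (arr_cmax az' mem).
Qed.

Lemma arr_id J : arranges J J (cmax (id_dcoset J)) [::] /\
  cmax (id_dcoset J) \in dcoset_set (id_dcoset J).
Proof.
have az : arranges J J (longest J) [::].
  by split=> // [|a]; [apply: ldes_longest | rewrite blk_longest].
have mem : longest J \in dcoset_set (id_dcoset J).
  rewrite /= /dcos -[longest J]mul1g -[X in X * _]mulg1.
  by rewrite !mem_mulg ?set11 ?group1 ?longest_parab.
by rewrite (arr_cmax az mem).
Qed.

(** * Dictionary between atomic expressions and sorting words *)

Lemma nth_cut I k d : onth (enum (~: I)) k = Some d -> d \notin I /\ blk I d = k.+1.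
Proof.
move=> hk; have ds : d \in enum (~: I) by apply/onthP; exists k.
split; first by rewrite mem_enum inE in ds.
have lt_k : k < size (enum (~: I)) by rewrite -onthTE hk.
(* The cuts before [d] are the [k] entries preceding it in the increasing enumeration. Blocks count
   from 1, so the block ending at [d] has number [k.+1], the letter recorded by [atomic_rex]. *)
have -> : blk I d = (count (fun c : 'I_n.-1 => c < d) (enum (~: I))).+1.
  rewrite /blk cardE !size_filter /enum_mem count_filter; congr S.
  by apply: eq_count => c; rewrite !inE /= andbC.
have : pairwise (fun c e : 'I_n.-1 => c < e) (enum (~: I)).
  rewrite -sorted_pairwise; last by move=> ? ? ?; apply: ltn_trans.
  apply: sorted_filter; first by move=> ? ? ?; apply: ltn_trans.
  by rewrite -(@sorted_map _ _ val ltn) unlock val_ord_enum iota_ltn_sorted.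
rewrite -(cat_take_drop k (enum _)) (drop_nth d lt_k) (onth_nth _ _ _ _ hk).
rewrite pairwise_cat /= allrel_consr => /and3P[/andP[lt_d _] _ /andP[gt_d _]].
rewrite count_cat /= ltnn add0n.
have -> : count (fun c : 'I_n.-1 => c < d) (drop k.+1 (enum (~: I))) = 0.
  apply/eqP; rewrite -leqn0 leqNgt -has_count -all_predC.
  by apply: sub_all gt_d => c /= lt_dc; rewrite -leqNgt ltnW.
by move: lt_d; rewrite all_count => /eqP->; rewrite size_takel ?addn0 // ltnW.
Qed.

Lemma cut_exists I k : k < #|~: I| -> exists d, onth (enum (~: I)) k = Some d.
Proof.
by rewrite cardE -onthTE; case: onth => // d _; exists d.
Qed.

(** [#|~: J|.+1] is the number of blocks, preserved by atomic cosets; reducedness of each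
    composition supplies the inequality in [sorting]. *)
Lemma rex_arranges J I (p : dcoset I J) w : atomic_rex p w ->
  [/\ arranges J I (cmax p) w, cmax p \in dcoset_set p & sorting #|~: J|.+1 w].
Proof.
elim=> {I p w} [|I p w k d _ [az _ sw_w] hk red]; first by have [] := arr_id J.
have [dI ek] := nth_cut hk; have [az' mem] := arr_dcompose dI az red.
rewrite -ek; split=> //; have eJ := arr_cardC az.
rewrite /= (act_lt_reduced dI az red) sw_w !andbT ek /= ltnS -eJ cardE.
by rewrite -onthTE hk.
Qed.

Lemma sorting_rex J w : sorting #|~: J|.+1 w ->
  exists I (p : dcoset I J), atomic_rex p w.
Proof.
elim: w => [_|[|k] w IH] /=; rewrite ?ltnn //.
  by exists J, (id_dcoset J); apply: Atomic_nil.
case/and3P=> ltk lt_act /IH[I [p rexp]].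
have [az _ _] := rex_arranges rexp.
have eJ : #|~: I| = #|~: J| by apply: arr_cardC az.
have [|d hd] := @cut_exists I k; first by rewrite eJ.
have [dI ek] := nth_cut hd.
exists (atomic_left I d), (dcompose (atomic I d) p); apply: Atomic_cons => //.
by apply: (reduced_act_lt dI az); rewrite ek.
Qed.

Lemma incr_perm1 u : (forall i, u (lo i) < u (hi i)) -> u = 1.
Proof.
move=> inc; rewrite -(redword_prod u).
have [[|i s] /= _] : exists2 s, size s = ell u & redword u = s :> seq _.
  by exists (redword u); rewrite ?size_tuple.
  by move=> ->; rewrite /word_prod big_nil.
move=> es; have red : ell (word_prod (i :: s)) = size (i :: s).
  by rewrite -es redword_prod size_tuple.
have [lt' _] := reduced_word_cons red; have := inc i.
rewrite -(redword_prod u) es word_cons !permM simple_lo simple_hi => lt2.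
by have := ltn_trans lt' lt2; rewrite ltnn.
Qed.

(** [z * z'^-1] preserves block numbers, and also the order inside blocks since [z] and [z'] both
    reverse it; having no descent, it is trivial. The block numbers then agree, so the cuts do. *)
Lemma arranges_uniq J I I' z z' w w' : arranges J I z w -> arranges J I' z' w' ->
  wact w =1 wact w' -> I = I' /\ z = z'.
Proof.
move=> [_ dz bz] [_ dz' bz'] eact.
have ez : z = z'.
  suff e1 : z * z'^-1 = 1 by rewrite -[z](mulgKV z') e1 mul1g.
  apply: incr_perm1 => i; set u := z * z'^-1.
  have zu a : z' (u a) = z a by rewrite permM permKV.
  have bu a : blk I' (u a) = blk I a.
    by apply: (@wact_inj w); rewrite -bz -zu bz' eact.
  rewrite ltnNge leq_eqVlt; apply/negP=> /orP[/eqP/val_inj/perm_inj e|lt'].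
    by have := lo_neq_hi i; rewrite e eqxx.
  have eb : blk I (lo i) = blk I (hi i).
    by apply/eqP; rewrite eqn_leq blk_mono ?leqnSn // -(bu (lo i)) -(bu (hi i)) blk_mono // ltnW.
  have h1 := ldes_chain dz (ltnSn _ : lo i < hi i) eb.
  have := ldes_chain dz' lt'; rewrite !bu !zu => /(_ (esym eb)).
  by rewrite ltnNge ltnW.
split=> //; apply/setP=> i; rewrite -!blk_lo_hi.
have bI a : blk I a = blk I' a by apply: (@wact_inj w); rewrite -bz ez bz' eact.
by rewrite !bI.
Qed.

Lemma arranges_act J I z w w' : arranges J I z w -> arranges J I z w' ->
  sorting #|~: J|.+1 w -> sorting #|~: J|.+1 w' -> wact w =1 wact w'.
Proof.
move=> [cI _ bz] [_ _ bz'] so so' k; set m := #|~: J|.+1 in so so'.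
have eJ : #|~: I| = #|~: J| by apply: (@addnI #|I|); rewrite cardsC cI cardsC.
have agree a : wact w (blk I a) = wact w' (blk I a) by rewrite -bz bz'.
(* A number [l] in this range is that of the block ending at some cut, and [l.+1] that of the next
   block. *)
have cut l : 0 < l < m -> wact w l = wact w' l /\ wact w l.+1 = wact w' l.+1.
  case: l => // l /= ltl; have [|d /nth_cut[dI ed]] := @cut_exists I l; first by rewrite eJ.
  have := agree (lo d); have := agree (hi d).
  by rewrite [blk I (hi d)](blkS I d) dI addn1 /= ed => -> ->.
have [k0|] := boolP ((k == 0) || (m < k)); first by rewrite !(@wact_fix m).
rewrite negb_or -lt0n -leqNgt => /andP[k0]; rewrite leq_eqVlt => /orP[/eqP ek|ltk].
  case: k ek k0 => // k ek _; case: k ek => [|k] ek; last by apply: (cut k.+1 _).2; lia.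
  (* Without cuts [m] is 1, and no letter satisfies [0 < i < m]. *)
  suff nil (v : seq nat) : sorting m v -> v = [::] by rewrite (nil w so) (nil w' so').
  by case: v => //= i v; rewrite -ek; lia.
by have [] := cut k; rewrite ?k0.
Qed.

(** The word [w'] expresses some coset by [sorting_rex]; equal actions force the same left subset
    and the same maximal element, hence the same coset. *)
Lemma rex_transfer J I (p : dcoset I J) w w' : atomic_rex p w ->
  sorting #|~: J|.+1 w' -> wact w =1 wact w' -> atomic_rex p w'.
Proof.
move=> /rex_arranges[az mem _] /sorting_rex[I' [p' rex']] eact.
have [az' mem' _] := rex_arranges rex'; have [eI ez] := arranges_uniq az az' eact.
subst I'; suff -> : p = p' by [].
by rewrite (dcoset_of_eq mem) ez -(dcoset_of_eq mem').
Qed.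

End Atomic.

Theorem theorem3p14 (n : nat) (I J : {set 'I_n.-1}) (p : dcoset I J) :
  is_core p ->
  forall w w' : seq nat, atomic_rex p w -> atomic_rex p w' ->
    clos_refl_sym_trans (seq nat) (braid_step p) w w'.
Proof.
move=> _ w w' rex rex'.
have [az _ so] := rex_arranges rex; have [az' _ so'] := rex_arranges rex'.
have := sorting_matsumoto so so' (arranges_act az az' so so').
move=> H; move: H rex rex' {az so az' so'}; elim=> {w w'}.
- by move=> w w' [_ _ _ b] rex rex'; apply: rst_step.
- by move=> w _ _; apply: rst_refl.
- by move=> w w' _ IH rex rex'; apply/rst_sym/IH.
(* The middle word [v] is a priori only a sorting word with the same action; [rex_transfer] makes it
   an expression of [p]. *)
move=> u v w uv IHuv _ IHvw rexu rexw.
have [_ _ so] := rex_arranges rexu; have [sov euv _] := braided_inv uv so.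
have rexv := rex_transfer rexu sov euv.
exact: rst_trans (IHuv rexu rexv) (IHvw rexv rexw).
Qed.
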